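(* Let $0<\delta<1$, $\epsilon>0$, $\Delta>0$, $0<c<1$, and let $$M=\left\lceil\frac{8\Delta^2}{9\epsilon^2(1-c)^2}\log\frac4\delta\right\rceil .$$ Suppose the sampling algorithm (Algorithm 1, described in the context) has failure probability at most $\frac{\delta}{4M}$ per call and target error $c\epsilon$ for the first moment. Then the Gaussian ground state energy estimation algorithm (Algorithm 2, described in the context), which uses $M$ calls of Algorithm 1, outputs an estimate $\hat\mu_1$ such that $|\hat\mu_1-\tilde\mu_1|\le\epsilon$ with total failure probability at most $\delta$.
   Context: $\log$ is the natural logarithm. $H$ is a Hamiltonian with ground state energy $E_0$ and spectral gap at least $\Delta$; $\tilde\mu_1=E_0$ is the first moment (mean) of the Gaussian centred at the ground state energy. Algorithm 1 is a randomized sampling procedure (it runs a Gaussian-window quantum phase estimation circuit several times and keeps only the outcomes near the lowest one). Each call is independent of the others. ''Failure probability at most $p$ and target error $c\epsilon$'' means: each call fails with probability at most $p$, and, when it does not fail, it returns at least one sample of a random variable $x$ which satisfies $|x-E_0|\le\frac23\Delta$ (so $x$ lies in an interval of length at most $b=\frac{4\Delta}{3}$) and $|\mathbb E(x)-\tilde\mu_1|<c\epsilon$. Algorithm 2: call Algorithm 1 independently $M$ times with the parameters above, take a sample $x_i$ of $x$ from the $i$-th call, and return the sample average $\hat\mu_1=\frac1M\sum_{i=1}^M x_i$. *)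

(* Defs.v *)
From HB Require Import structures.
From mathcomp Require Import all_boot all_order all_algebra.
From mathcomp Require Import spectral complex.
From mathcomp Require Import all_classical all_reals all_analysis.

Set Implicit Arguments.
Unset Strict Implicit.
Unset Printing Implicit Defensive.

Import Order.TTheory GRing.Theory Num.Theory.
Import numFieldNormedType.Exports.

Local Open Scope classical_set_scope.
Local Open Scope ring_scope.

Section hamiltonian.
Context {R : realType} {n : nat}.
Implicit Types H : 'M[R[i]]_n.

Definition is_hamiltonian H : Prop := H \is hermsymmx.

(* The eigenvalues of a Hermitian matrix are real, so the spectrum is tested
   on the image of R in R[i] only. *)
Definition is_ground_energy H (E0 : R) : Prop :=
  eigenvalue H E0%:C%C /\ forall l : R, eigenvalue H l%:C%C -> E0 <= l.

(* A degenerate ground energy is allowed: the gap separates E0 from the other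
   points of the spectrum. *)
Definition gap_at_least H (E0 Delta : R) : Prop :=
  forall l : R, eigenvalue H l%:C%C -> l != E0 -> E0 + Delta <= l.

End hamiltonian.

(* One call of the sampling algorithm, on the sample space T: the event that the
   call fails, and the list of the samples it returns. The list is meaningful
   only outside the failure event. *)
Record sampling_call (R : realType) d (T : measurableType d) := SamplingCall {
  failed : set T ;
  returned : T -> seq R }.

Section sampling.
Context {R : realType} {d : measure_display} {T : measurableType d}.
Variable P : probability T R.

Definition reliable_call (C : sampling_call R T) (p : R) : Prop :=
  [/\ measurable (failed C), (P (failed C) <= p%:E)%E &
      forall w, ~ failed C w -> returned C w != [::] ].

(* X is a sample of x taken from the call C: when C does not fail, X is one of
   the values returned by C, and the conditional law of X given that C does not
   fail is the law of x, i.e. P(X \in B | not failed) = Q(x \in B). Nothing is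
   assumed on X when C fails. *)
Definition sample_taken (C : sampling_call R T) (X : {RV P >-> R})
    d' (T' : measurableType d') (Q : probability T' R) (x : {RV Q >-> R}) : Prop :=
  (forall w, ~ failed C w -> X w \in returned C w) /\
  (forall B : set R, measurable B ->
     P (~` failed C `&` X @^-1` B) = (P (~` failed C) * Q (x @^-1` B))%E).

Definition call_events (C : sampling_call R T) (X : {RV P >-> R}) : set (set T) :=
  <<s [set failed C] `|` [set X @^-1` B | B in @measurable _ R] >>.

Definition mutually_independent (I : finType) (G : I -> set (set T)) : Prop :=
  forall (J : {set I}) (A : I -> set T), (forall i, i \in J -> G i (A i)) ->
    P (\bigcap_(i in [set` J]) A i) = (\prod_(i in J) P (A i))%E.

Definition sample_average M (X : 'I_M -> {RV P >-> R}) (w : T) : R :=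
  M%:R^-1 * \sum_(i < M) X i w.

(* The estimation fails if one of its calls fails, or if the average of the
   samples is not within eps of mu1. *)
Definition estimation_failure M (C : 'I_M -> sampling_call R T)
    (X : 'I_M -> {RV P >-> R}) (mu1 eps : R) : set T :=
  [set w | (exists i, failed (C i) w) \/ ~ (`|sample_average X w - mu1| <= eps)].

End sampling.

Definition target_variable (R : realType) d (T : measurableType d)
    (Q : probability T R) (x : {RV Q >-> R}) (E0 Delta mu1 tol : R) : Prop :=
  {ae Q, forall w, `|x w - E0| <= 2 / 3 * Delta} /\
  (`|'E_Q[x] - mu1%:E| < tol%:E)%E.

(* Main.v *)
(** Hoeffding's inequality, run on the calls that do not fail.  Nothing is known
about the sample of a failed call, so its exponential moment is censored: the
variables 1_{not failed} exp(lam (x_i - E0)) are independent, and the mean of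
each is at most E_Q[exp(lam (x - E0))], which is bounded by Hoeffding's lemma on
[-2 Delta / 3, 2 Delta / 3].  With deviation (1 - c) eps this costs delta / 4
for each tail; the failures of the calls cost another delta / 4. *)
Require Import Defs.
From HB Require Import structures.
From mathcomp Require Import all_boot all_order all_algebra.
From mathcomp Require Import spectral complex.
From mathcomp Require Import all_classical all_reals all_analysis.
From mathcomp Require Import measurable_realfun ring lra.

Import Order.TTheory GRing.Theory Num.Theory.
Import numFieldNormedType.Exports.

Local Open Scope classical_set_scope.
Local Open Scope ring_scope.

(** * Hoeffding's lemma for almost surely bounded variables *)

(** The left side is the exponential moment of a variable with values [u] and [- u] and mean
    [s * u]. As a function [p] of [u] it has derivative [q], with [q' = p]. So [ln p] has slope [s]
    at 0 and second derivative [1 - (q / p) ^+ 2], at most 1; integrating twice gives the exponent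
    on the right. *)
Lemma chord_expR_le (R : realType) (s u : R) : `|s| <= 1 -> 0 <= u ->
  (1 + s) / 2 * expR u + (1 - s) / 2 * expR (- u) <= expR (s * u + u ^+ 2 / 2).
Proof.
rewrite ler_norml => /andP[s1 s2] u0.
pose p (v : R) := (1 + s) / 2 * expR v + (1 - s) / 2 * expR (- v).
pose q (v : R) := (1 + s) / 2 * expR v - (1 - s) / 2 * expR (- v).
have p0 v : 0 < p v.
  have := expR_gt0 v; have := expR_gt0 (- v); rewrite /p => ? ?; nra.
have p00 : p 0 = 1 by rewrite /p oppr0 expR0; field.
have q00 : q 0 = s by rewrite /q oppr0 expR0; field.
have dp (v : R) : is_derive v 1 p (q v).
  by apply: is_derive_eq; rewrite /q /GRing.scale/=; ring.
have dq (v : R) : is_derive v 1 q (p v).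
  by apply: is_derive_eq; rewrite /p /GRing.scale/=; ring.
have continuousW (f f' : R -> R) (D : set R) :
    (forall v : R, is_derive v 1 f (f' v)) -> {within D, continuous f}.
  move=> df; apply: continuous_subspaceT => v.
  by apply: differentiable_continuous; apply/derivable1_diffP; have [] := df v.
(* [q / p] is [tanh (v + artanh s)], whose slope is at most [1]. *)
have h0 v : 0 <= v -> q v <= (s + v) * p v.
  move=> v0; rewrite -ler_pdivrMr// -subr_ge0.
  pose k (w : R) := s + w - q w * (p w)^-1.
  have dk (w : R) : is_derive w 1 k ((q w / p w) ^+ 2).
    have pN0 : p w != 0 by rewrite gt_eqF.
    have dV := is_deriveV pN0 (dp w).
    apply: is_derive_eq; rewrite /GRing.scale/=.
    by move: (p w) (q w) pN0 => a b ?; field.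
  have k00 : k 0 = 0 by rewrite /k p00 q00; field.
  rewrite -[_ - _]/(k v) -k00.
  apply: (@ger0_derive1_ndecry _ k 0) => // [w _|].
  - by rewrite derive1E derive_val sqr_ge0.
  - exact: continuousW dk.
(* [G' = ((s + v) p - q) e >= 0], where [e] is the inverse of the bound, so that
   [p * e] decreases from [1]. *)
pose e (v : R) := expR (- (s * v + v ^+ 2 / 2)).
have de (v : R) : is_derive v 1 e (- (s + v) * e v).
  by apply: is_derive_eq; rewrite /GRing.scale/= /e; field.
pose G (v : R) := - (p v * e v).
have dG (v : R) : is_derive v 1 G (((s + v) * p v - q v) * e v).
  by apply: is_derive_eq; rewrite /GRing.scale/=; ring.
have : G 0 <= G u.
  apply: (@ger0_derive1_ndecry _ G 0) => // [w|].
  - rewrite in_itv/= andbT => /ltW w0.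
    by rewrite derive1E derive_val mulr_ge0 ?expR_ge0// subr_ge0 h0.
  - exact: continuousW dG.
have -> : G 0 = -1.
  by rewrite /G /e p00 mulr0 expr0n/= mul0r addr0 oppr0 expR0 mul1r.
rewrite lerN2 /e expRN ler_pdivrMr ?expR_gt0// mul1r.
exact.
Qed.

(** Convexity of the exponential: [lam * z] is the convex combination of [lam * r] and [- (lam * r)]
    with weight [(1 + z / r) / 2] on the former. *)
Lemma expR_le_chord (R : realType) (z r lam : R) : 0 < r -> `|z| <= r ->
  expR (lam * z) <= (1 + z / r) / 2 * expR (lam * r)
                    + (1 - z / r) / 2 * expR (- (lam * r)).
Proof.
move=> r0; rewrite ler_norml => /andP[z1 z2].
have zr1 : z / r <= 1 by rewrite ler_pdivrMr// mul1r.
have zr2 : -1 <= z / r by rewrite ler_pdivlMr// mulN1r.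
have t0 : 0 <= (1 + z / r) / 2 by lra.
have t1 : (1 + z / r) / 2 <= 1 by lra.
have := convex_expR (Itv01 t0 t1) (lam * r) (- (lam * r)).
rewrite !convRE/= /unstable.onem.
have -> : (1 + z / r) / 2 * (lam * r) + (1 - (1 + z / r) / 2) * - (lam * r) =
    lam * z.
  by field; rewrite gt_eqF.
by have -> : 1 - (1 + z / r) / 2 = (1 - z / r) / 2 by field; rewrite gt_eqF.
Qed.

Lemma ae_bounded_integrable (R : realType) d (T : measurableType d)
    (Q : probability T R) (f : T -> R) (r : R) :
  measurable_fun setT f -> {ae Q, forall w, `|f w| <= r} ->
  Q.-integrable setT (EFin \o f).
Proof.
move=> mf fr; apply/integrableP; split; first exact/measurable_EFinP.
(* The sign of [r] is not known at this point; its absolute value gives a dominating constant that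
   is nonnegative everywhere. *)
apply: (@le_lt_trans _ _ (\int[Q]_w (cst `|r|%:E w))%E).
  apply: ae_ge0_le_integral => //.
    by apply/measurable_EFinP; apply: measurableT_comp.
    by move=> w _; rewrite lee_fin.
  by apply: filterS fr => w frw _; rewrite lee_fin (le_trans frw)// ler_norm.
by rewrite integral_cst// [X in (_ * X)%E](probability_setT Q) mule1 ltry.
Qed.

(** The chord bound is affine in the variable, so its integral depends on the law only through the
    mean [m]; then [chord_expR_le] applies with [s = m / r] and [u = lam * r]. Leaving the mean [m]
    free lets the bias of the sampler be carried along. *)
Lemma expectation_expR_le (R : realType) d (T : measurableType d)
    (Q : probability T R) (Z : T -> R) (r lam m : R) :
  measurable_fun setT Z -> 0 < r -> 0 <= lam ->
  {ae Q, forall w, `|Z w| <= r} -> (\int[Q]_w (Z w)%:E)%E = m%:E ->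
  (\int[Q]_w (expR (lam * Z w))%:E <=
   (expR (lam * m + (lam * r) ^+ 2 / 2))%:E)%E.
Proof.
move=> mZ r0 lam0 Zr EZ.
(* [V] is [Z] clamped to [[-r, r]], so that bounds hold everywhere. *)
pose V (w : T) : R := Num.max (- r) (- Num.max (- r) (- Z w)).
have mV : measurable_fun setT V.
  apply: measurable_maxr => //; apply: measurableT_comp => //.
  by apply: measurable_maxr => //; apply: measurableT_comp.
have Vr w : `|V w| <= r.
  rewrite /V ler_norml ge_max !le_max lexx/=.
  by rewrite (lerNl (Num.max _ _)) le_max lexx/=; lra.
have ZV : ae_eq Q setT Z V.
  apply: filterS Zr => w Zrw _; rewrite /V.
  move: Zrw; rewrite ler_norml => /andP[z1 z2].
  have /max_idPr -> : - r <= - Z w by rewrite lerN2.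
  by rewrite opprK; apply/esym/max_idPr.
have iV : Q.-integrable setT (EFin \o V).
  by apply: (@ae_bounded_integrable _ _ _ _ _ r) => //; exact/aeW.
have EV : (\int[Q]_w (V w)%:E)%E = m%:E.
  rewrite -EZ; apply: ae_eq_integral => //; [exact/measurable_EFinP..|].
  by apply: filterS ZV => w /[apply] /= ->.
have mexp (U : T -> R) : measurable_fun setT U ->
    measurable_fun setT (fun w => (expR (lam * U w))%:E).
  move=> mU; apply/measurable_EFinP; apply: measurableT_comp => //.
  exact: measurable_funM.
rewrite (ae_eq_integral (fun w => (expR (lam * V w))%:E))//;
  [|exact: mexp..|]; last by apply: filterS ZV => w /[apply] /= ->.
pose e1 := expR (lam * r); pose e2 := expR (- (lam * r)).
(* The chord written as intercept plus slope times [V w], ready for linearity of the integral. *)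
apply: (@le_trans _ _
  (\int[Q]_w ((e1 + e2) / 2 + (e1 - e2) / (2 * r) * V w)%:E)%E).
  apply: ge0_le_integral => //; first exact: mexp.
    by apply/measurable_EFinP/measurable_funD => //; exact: measurable_funM.
  move=> w _; rewrite lee_fin (le_trans (expR_le_chord _ _ _ lam r0 (Vr w)))//.
  rewrite -/e1 -/e2 le_eqVlt; apply/orP; left; apply/eqP.
  by field; rewrite gt_eqF.
under eq_integral do rewrite EFinD (EFinM _ (V _)).
rewrite integralD//;
  [|exact: finite_measure_integrable_cst|exact: integrableZl].
rewrite (integralZl measurableT iV) EV integral_cst//.
rewrite [X in (_ * X + _)%E](probability_setT Q) mule1.
rewrite -EFinM -EFinD lee_fin.
(* The mean of a variable with values in [-r, r] lies in the same interval. *)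
have m1 : `|m / r| <= 1.
  rewrite normrM normfV (gtr0_norm r0) ler_pdivrMr// mul1r.
  rewrite -lee_fin -abse_EFin -EV.
  apply: (le_trans (le_abse_integral _ _ _)) => //; first exact/measurable_EFinP.
  rewrite (_ : r%:E = \int[Q]_w (cst r%:E w))%E; last first.
    by rewrite integral_cst// [X in (_ * X)%E](probability_setT Q) mule1.
  apply: ge0_le_integral => //.
    by apply/measurable_EFinP; apply: measurableT_comp.
  by move=> w _; rewrite lee_fin.
have := chord_expR_le _ _ _ m1 (mulr_ge0 lam0 (ltW r0)).
rewrite (_ : m / r * (lam * r) = lam * m); last by field; rewrite gt_eqF.
apply: le_trans; rewrite -/e1 -/e2 le_eqVlt; apply/orP; left; apply/eqP.
by field; rewrite gt_eqF.
Qed.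

(** * Transfer of integrals between equal weighted laws *)

Section equal_weighted_laws.
Context {R : realType} {d1 d2 d3 : measure_display}.
Context {T1 : measurableType d1} {T2 : measurableType d2} {S : measurableType d3}.
Variables (mu : {measure set T1 -> \bar R}) (nu : {measure set T2 -> \bar R}).
Import HBNNSimple.
Local Open Scope ereal_scope.

(** Splitting [h] along its level sets leaves only integrals of the weight over preimages under [X],
    which are the quantities that a weighted law prescribes. *)
Lemma ge0_integral_mul_nnsfun d (T : measurableType d)
    (m : {measure set T -> \bar R}) (X : T -> S) (W : T -> R)
    (h : {nnsfun S >-> R}) :
  measurable_fun setT X -> measurable_fun setT W -> (forall w, 0 <= W w)%R ->
  \int[m]_w (W w * h (X w))%:E =
  \sum_(k \in range h) k%:E * \int[m]_(w in X @^-1` (h @^-1` [set k])) (W w)%:E.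
Proof.
move=> mX mW W0.
have mpre k : measurable (X @^-1` (h @^-1` [set k])).
  by rewrite -[X in measurable X]setTI; exact: mX.
transitivity (\int[m]_w \sum_(k \in range h)
    ((W w * (k * \1_(h @^-1` [set k]) (X w)))%:E)).
  by apply: eq_integral => w _; rewrite fimfunE mulr_fsumr fsumEFin.
have mk k : measurable_fun setT (fun w => \1_(h @^-1` [set k]) (X w) : R).
  exact: (measurable_indic (mpre k)).
rewrite ge0_integral_fsum//; last 2 first.
- move=> k; apply/measurable_EFinP; apply: measurable_funM => //.
  exact: measurable_funM.
- move=> k w _; have := nnfun_muleindic_ge0 h k (X w).
  by rewrite -EFinM !lee_fin; exact: mulr_ge0.
apply: eq_fsbigr => k /[!inE] -[y _ <-].
rewrite [in RHS]integral_mkcond epatch_indic -ge0_integralZl//.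
- by apply: eq_integral => w _ /=; rewrite -!EFinM; congr EFin; rewrite mulrCA.
- apply: emeasurable_funM; apply/measurable_EFinP; first exact: mW.
  exact: measurable_indic.
- by move=> w _ /=; rewrite -EFinM lee_fin mulr_ge0.
- by rewrite lee_fin.
Qed.

(** The measures with densities [W1] and [W2] have the same image on [S], so they integrate [phi]
    alike: first for simple functions, then by monotone convergence. This serves both to pass from
    the sample of a call to [x], across two spaces, and to factor expectations under
    independence. *)
Lemma eq_integral_weighted_law (X1 : T1 -> S) (X2 : T2 -> S)
    (W1 : T1 -> R) (W2 : T2 -> R) (phi : S -> R) :
  measurable_fun setT X1 -> measurable_fun setT X2 ->
  measurable_fun setT W1 -> measurable_fun setT W2 ->
  (forall w, 0 <= W1 w)%R -> (forall w, 0 <= W2 w)%R ->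
  (forall B, measurable B -> \int[mu]_(w in X1 @^-1` B) (W1 w)%:E =
                             \int[nu]_(w in X2 @^-1` B) (W2 w)%:E) ->
  measurable_fun setT phi -> (forall s, 0 <= phi s)%R ->
  \int[mu]_w (W1 w * phi (X1 w))%:E = \int[nu]_w (W2 w * phi (X2 w))%:E.
Proof.
move=> mX1 mX2 mW1 mW2 W10 W20 eqlaw mphi phi0.
have mEphi : measurable_fun setT (EFin \o phi) by exact/measurable_EFinP.
pose h := nnsfun_approx measurableT mEphi.
have lim_h d (T : measurableType d) (m : {measure set T -> \bar R})
    (X : T -> S) (W : T -> R) : measurable_fun setT X ->
    measurable_fun setT W -> (forall w, 0 <= W w)%R ->
    \int[m]_w (W w * phi (X w))%:E =
    limn (fun n => \int[m]_w (W w * h n (X w))%:E).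
  move=> mX mW W0; rewrite -monotone_convergence//.
  - apply: eq_integral => w _; apply/esym/cvg_lim => //.
    rewrite EFinM; under eq_fun do rewrite EFinM.
    apply: cvgeZl => //.
    by apply: (cvg_nnsfun_approx measurableT mEphi) => // s _; rewrite lee_fin.
  - move=> n; apply/measurable_EFinP/measurable_funM => //.
    by apply: measurableT_comp.
  - by move=> n w _; rewrite lee_fin mulr_ge0.
  - move=> w _ n n' nn'; rewrite lee_fin ler_wpM2l//.
    exact/lefP/nd_nnsfun_approx.
rewrite !lim_h//; congr (limn _); apply/funext => n.
rewrite !ge0_integral_mul_nnsfun//; apply: eq_fsbigr => k _.
by rewrite eqlaw.
Qed.

End equal_weighted_laws.

(** * Expectation of a product of independent variables *)

Lemma expectation_prod_independent (R : realType) d (T : measurableType d)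
    (P : probability T R) (I : finType) (Y : I -> T -> R) :
  (forall i, measurable_fun setT (Y i)) -> (forall i w, 0 <= Y i w) ->
  (forall i, P.-integrable setT (EFin \o Y i)) ->
  (forall A : I -> set R, (forall i, measurable (A i)) ->
    P (\bigcap_i (Y i @^-1` A i)) = (\prod_i P (Y i @^-1` A i))%E) ->
  (\int[P]_w (\prod_i Y i w)%:E = \prod_i \int[P]_w (Y i w)%:E)%E.
Proof.
move=> mY Y0 iY indep.
(* Replace the indicators of the events [Y i \in A i] by the variables [Y i],
   one index at a time. *)
pose f (s : seq I) (A : I -> set R) i : T -> R :=
  if i \in s then Y i else \1_(Y i @^-1` A i).
have mpre i B : measurable B -> measurable (Y i @^-1` B).
  by move=> mB; rewrite -[X in measurable X]setTI; exact: mY.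
have mf s A i : (forall i, measurable (A i)) -> measurable_fun setT (f s A i).
  move=> mA; rewrite /f; case: ifP => _; first exact: mY.
  by apply: measurable_indic; exact: mpre.
have f0 s A i w : 0 <= f s A i w by rewrite /f; case: ifP.
have intf s A i : (forall i, measurable (A i)) ->
    (\int[P]_w (f s A i w)%:E \is a fin_num)%E.
  move=> mA; rewrite /f; case: ifP => _; first exact: integrable_fin_num (iY i).
  rewrite integral_indic ?setIT//; last exact: mpre.
  by apply: fin_num_measure; exact: mpre.
(* The events [A] stay universally quantified, because the induction on [s] has to change the event
   at the index being treated. *)
suff main s A : (forall i, measurable (A i)) ->
    (\int[P]_w (\prod_i f s A i w)%:E = \prod_i \int[P]_w (f s A i w)%:E)%E.
  have := main (enum I) (fun=> setT) (fun=> measurableT).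
  have -> // : f (enum I) (fun=> setT) = Y.
  by apply/funext => i; apply/funext => w; rewrite /f mem_enum.
elim: s A => [|x s IH] A mA.
  have -> : (\prod_i \int[P]_w (f [::] A i w)%:E =
             P (\bigcap_i (Y i @^-1` A i)))%E.
    rewrite indep//; apply: eq_bigr => i _.
    by rewrite /f /= integral_indic ?setIT//; exact: mpre.
  rewrite -[X in P X]setIT -integral_indic//; last first.
    by apply: fin_bigcap_measurable => [|i _];
      [exact: finite_finset|exact: mpre].
  apply: eq_integral => w _; congr EFin.
  have [h|/existsNP[i hi]] := pselect (forall i, A i (Y i w)).
    rewrite [RHS]indicE mem_set; last by move=> i _; exact: h.
    by rewrite big1// => i _; rewrite /f /= indicE mem_set//; exact: h.
  rewrite [RHS]indicE memNset; last by move/(_ i Logic.I); exact: hi.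
  by rewrite (bigD1 i)//= /f /= indicE memNset ?mul0r.
have [xs|xs] := boolP (x \in s).
  have -> : f (x :: s) A = f s A.
    apply/funext => i; apply/funext => w; rewrite /f inE.
    by case: eqVneq => // ->; rewrite xs.
  exact: IH.
pose W w := \prod_(i | i != x) f s A i w.
pose c := (\prod_(i | i != x) \int[P]_w (f s A i w)%:E)%E.
have cfin : c \is a fin_num by apply: prode_fin_num => i _; exact: intf.
have fxE w : f (x :: s) A x w = Y x w by rewrite /f mem_head.
have fE i : i != x -> f (x :: s) A i = f s A i.
  by move=> ix; apply/funext => w; rewrite /f inE (negbTE ix).
rewrite [RHS](bigD1 x)//=; under [in RHS]eq_integral do rewrite fxE.
rewrite [X in (_ * X)%E](_ : _ = c); last first.
  by apply: eq_bigr => i ix; rewrite fE.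
(* The transfer lemma wants a test function that is nonnegative on all of [R]; since [Y x] is
   nonnegative, the absolute value can play that part. *)
transitivity (\int[P]_w (W w * `|Y x w|)%:E)%E.
  apply: eq_integral => w _; rewrite (bigD1 x)//= fxE ger0_norm// mulrC.
  by congr ((_ * _)%:E); apply: eq_bigr => i ix; rewrite fE.
have W0 w : 0 <= W w by apply: prodr_ge0.
have c0 : 0 <= fine c.
  apply/fine_ge0/prode_ge0 => i _.
  by apply: integral_ge0 => w _; rewrite lee_fin.
rewrite (@eq_integral_weighted_law _ _ _ _ _ _ _ P P (Y x) (Y x) W
  (cst (fine c)))//.
- under eq_integral do rewrite EFinM ger0_norm//.
  under eq_integral do rewrite -[cst _ _]/(fine c).
  rewrite ge0_integralZl// ?fineK// 1?muleC//; first exact/measurable_EFinP.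
  by move=> w _; rewrite lee_fin.
- apply: (eq_measurable_fun
    (fun w => \prod_(i <- [seq i <- index_enum I | i != x]) f s A i w)).
    by move=> w _; rewrite big_filter.
  by apply: measurable_prod => i _; exact: mf.
- move=> B mB.
  (* With the event at [x] set to [B], the induction hypothesis says that the integral of [W] over
     the event that [Y x] is in [B] equals [c] times its probability. So [Y x] has the same law
     under weight [W] as under the constant weight [fine c]. *)
  pose A' i := if i == x then B else A i.
  have mA' i : measurable (A' i) by rewrite /A'; case: ifP.
  have fA' i : i != x -> f s A' i = f s A i.
    by move=> ix; rewrite /f /A' (negbTE ix).
  have fx w : f s A' x w = \1_(Y x @^-1` B) w.
    by rewrite /f /A' (negbTE xs) eqxx.
  have := IH A' mA'; rewrite [X in _ = X -> _](bigD1 x)//=.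
  under [X in _ = (X * _)%E -> _]eq_integral do rewrite fx.
  rewrite integral_indic ?setIT//; last exact: mpre.
  rewrite [X in _ = (_ * X)%E -> _](_ : _ = c); last first.
    by apply: eq_bigr => i ix; rewrite fA'.
  rewrite integral_cst//; last exact: mpre.
  rewrite fineK// muleC => <-.
  rewrite integral_mkcond epatch_indic; apply: eq_integral => w _ /=.
  rewrite (bigD1 x)//= fx -EFinM mulrC.
  by congr ((_ * _)%:E); apply: eq_bigr => i ix; rewrite fA'.
Qed.

(** * Chernoff bound on the calls that do not fail *)

Section sampled_calls.
Context {R : realType} {d d' : measure_display}.
Context {T : measurableType d} {T' : measurableType d'}.
Variables (P : probability T R) (Q : probability T' R) (x : {RV Q >-> R}).

Let measurable_RV d1 (S : measurableType d1) (m : probability S R)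
    (Z : {RV m >-> R}) (g : R -> R) :
  measurable_fun setT g -> measurable_fun setT (g \o Z).
Proof. by move=> mg; exact: measurableT_comp. Qed.

Let measurable_pre d1 (S : measurableType d1) (m : probability S R)
    (Z : {RV m >-> R}) (B : set R) : measurable B -> measurable (Z @^-1` B).
Proof.
by move=> mB; rewrite -[X in measurable X]setTI; exact: measurable_funP.
Qed.

Lemma integral_sample_taken (C : sampling_call R T) (X : {RV P >-> R})
    (phi : R -> R) :
  measurable (failed C) -> sample_taken C X x ->
  measurable_fun setT phi -> (forall y, 0 <= phi y) ->
  (\int[P]_w (\1_(~` failed C) w * phi (X w))%:E =
   P (~` failed C) * \int[Q]_w (phi (x w))%:E)%E.
Proof.
move=> mF [_ law] mphi phi0; have mFC := measurableC mF.
have PF : P (~` failed C) \is a fin_num by exact: fin_num_measure.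
pose p := fine (P (~` failed C)).
have p0 : 0 <= p by rewrite fine_ge0.
rewrite (@eq_integral_weighted_law _ _ _ _ _ _ _ P Q X x
  (\1_(~` failed C)) (cst p))//.
- rewrite -(fineK PF) -ge0_integralZl//.
    by apply/measurable_EFinP; exact: measurable_RV.
  by move=> w _; rewrite lee_fin.
- move=> B mB; rewrite integral_indic//; last exact: measurable_pre.
  apply: (etrans (law B mB)).
  by rewrite -(fineK PF) -integral_cst//; exact: measurable_pre.
Qed.

(** Makes the independence of the calls apply to the censored variables, which depend only on the
    failure event and on [X]. *)
Lemma call_events_censored (C : sampling_call R T) (X : {RV P >-> R})
    (phi : R -> R) (B : set R) :
  measurable_fun setT phi -> measurable B ->
  call_events C X ((fun w => \1_(~` failed C) w * phi (X w)) @^-1` B).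
Proof.
move=> mphi mB.
pose G := [set failed C] `|` [set X @^-1` B | B in @measurable _ R].
rewrite /call_events -/G.
have mF : measurable (failed C : set (g_sigma_algebraType G)).
  by apply: sub_gen_smallest; left.
have mX : measurable (X @^-1` (phi @^-1` B) : set (g_sigma_algebraType G)).
  apply: sub_gen_smallest; right; exists (phi @^-1` B) => //.
  by rewrite -[X in measurable X]setTI; exact: mphi.
(* On failure the censored variable is 0, so the failing part of the preimage is all of [failed C]
   or empty, according to whether 0 is in [B]. *)
have -> : (fun w => \1_(~` failed C) w * phi (X w)) @^-1` B =
    (failed C `&` [set _ | B 0]) `|` (~` failed C `&` X @^-1` (phi @^-1` B)).
  apply/seteqP; split => w /=; have [Fw|Fw] := pselect (failed C w).
  - by rewrite indicE memNset ?mul0r; [left|move/(_ Fw)].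
  - by rewrite indicE mem_set// mul1r; right.
  - by rewrite indicE memNset ?mul0r; [case=> -[]|move/(_ Fw)].
  - by rewrite indicE mem_set// mul1r => -[[]|[]].
have [B0|B0] := pselect (B 0).
  have -> : [set _ : T | B 0] = setT by apply/seteqP; split.
  rewrite setIT; apply: (@measurableU _ (g_sigma_algebraType G)) => //.
  by apply: measurableI => //; exact: measurableC.
have -> : [set _ : T | B 0] = set0 by apply/seteqP; split.
rewrite setI0 set0U; apply: (@measurableI _ (g_sigma_algebraType G)) => //.
exact: measurableC.
Qed.

(** Chernoff's method: when every call succeeds, the product of the censored exponentials is the
    exponential of [lam] times the sum, and its mean factors by independence. The function [g] is
    left general so that the same bound gives both tails. *)
Lemma sampled_calls_tail M (C : 'I_M -> sampling_call R T)
    (X : 'I_M -> {RV P >-> R}) (g : R -> R) (r m t : R) :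
  (forall i, measurable (failed (C i))) ->
  (forall i, sample_taken (C i) (X i) x) ->
  mutually_independent P (fun i => call_events (C i) (X i)) ->
  measurable_fun setT g -> 0 < r -> 0 <= t ->
  {ae Q, forall w, `|g (x w)| <= r} -> (\int[Q]_w (g (x w))%:E = m%:E)%E ->
  (P ((\bigcap_i ~` failed (C i)) `&`
      [set w | M%:R * (m + t) <= \sum_i g (X i w)]%R) <=
   (expR (- (M%:R * t ^+ 2 / (2 * r ^+ 2))))%:E)%E.
Proof.
move=> mF taken indep mg r0 t0 gr Eg.
(* Minimizes the Chernoff exponent [- lam t + (lam r)^2 / 2]. *)
pose lam := t / r ^+ 2.
have lam0 : 0 <= lam by rewrite divr_ge0// sqr_ge0.
pose phi y := expR (lam * g y).
have phi0 y : 0 <= phi y by exact: expR_ge0.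
have mphi : measurable_fun setT phi.
  by apply: measurableT_comp => //; exact: measurable_funM.
pose Y i w := \1_(~` failed (C i)) w * phi (X i w) : R.
pose K := expR (lam * m + (lam * r) ^+ 2 / 2).
have Y0 i w : 0 <= Y i w by rewrite mulr_ge0.
have mY i : measurable_fun setT (Y i).
  apply: measurable_funM; last exact: measurable_RV.
  by apply: measurable_indic; exact: measurableC.
(* Censoring multiplies the exponential moment of [g (x w)] by the probability of success, at most
   1, so Hoeffding's bound [K] survives. *)
have YK i : (\int[P]_w (Y i w)%:E <= K%:E)%E.
  rewrite integral_sample_taken// -[leRHS]mul1e lee_pmul//.
  - by apply: integral_ge0 => w _; rewrite lee_fin.
  - by apply: probability_le1; exact: measurableC.
  - by apply: expectation_expR_le => //; exact: measurable_RV.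
have iY i : P.-integrable setT (EFin \o Y i).
  apply/integrableP; split; first exact/measurable_EFinP.
  under eq_integral do rewrite /= ger0_norm//.
  by rewrite (le_lt_trans (YK i))// ltry.
have EY : (\int[P]_w (\prod_i Y i w)%:E <= (K ^+ M)%:E)%E.
  rewrite expectation_prod_independent//; last first.
    move=> A mA.
    have := indep (finset.setTfor 'I_M) (fun i => Y i @^-1` A i).
    rewrite (_ : [set` _] = setT); last first.
      by apply/seteqP; split=> // i _ /=; rewrite inE.
    move=> ->; last by move=> i _; exact: call_events_censored.
    by apply: eq_bigl => i; rewrite inE.
  have Yfin i : (\int[P]_w (Y i w)%:E)%E \is a fin_num.
    exact: integrable_fin_num (iY i).
  under eq_bigr do rewrite -(fineK (Yfin _)).
  rewrite prodEFin lee_fin -[in leRHS](card_ord M) -prodr_const.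
  apply: ler_prod => i _; rewrite fine_ge0 ?integral_ge0//=; last first.
    by move=> w _; rewrite lee_fin.
  by rewrite -lee_fin fineK.
set A := (X in P X).
have mA : measurable A.
  apply: measurableI.
    apply: fin_bigcap_measurable; first exact: finite_finset.
    by move=> i _; exact: measurableC.
  rewrite -[X in measurable X]setTI.
  apply: measurable_fun_ler => //.
  by apply: measurable_sum => i; exact: measurable_RV.
pose a := expR (- (lam * (M%:R * (m + t)))).
(* Markov's inequality: [a] times the product is at least 1 on the event and nonnegative
   elsewhere. *)
apply: (@le_trans _ _ (\int[P]_w (a * \prod_i Y i w)%:E)%E).
  rewrite -[A in P A]setIT -integral_indic//.
  apply: ge0_le_integral => //.
  - by apply/measurable_EFinP; exact: measurable_indic.
  - apply/measurable_EFinP/measurable_funM => //.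
    by apply: measurable_prod => i _.
  move=> w _; rewrite lee_fin indicE; have [/set_mem Aw|_] := boolP (w \in A).
    have [nF Sw] := Aw.
    have -> : \prod_i Y i w = expR (lam * \sum_i g (X i w)).
      rewrite mulr_sumr expR_sum; apply: eq_bigr => i _.
      by rewrite /Y indicE mem_set ?mul1r//; exact: nF.
    rewrite -expRD -[leLHS]expR0 ler_expR -mulrN -mulrDr mulr_ge0//.
    by rewrite addrC subr_ge0.
  by rewrite mulr_ge0 ?expR_ge0// prodr_ge0.
under eq_integral do rewrite EFinM.
rewrite ge0_integralZl ?lee_fin ?expR_ge0//; last 2 first.
- by apply/measurable_EFinP/measurable_prod => i _.
- by move=> w _; rewrite lee_fin prodr_ge0.
rewrite (le_trans (lee_wpmul2l _ EY)) ?lee_fin ?expR_ge0//.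
rewrite -expRM_natl -expRD ler_expR le_eqVlt; apply/orP; left; apply/eqP.
by rewrite /lam; field; rewrite gt_eqF.
Qed.

End sampled_calls.

(** * Union bound and failure probability of the estimation *)

Lemma measure_finType_bigcup_le (R : realType) d (T : measurableType d)
    (P : probability T R) (I : finType) (F : I -> set T) (p : R) :
  (forall i, measurable (F i)) -> (forall i, (P (F i) <= p%:E)%E) ->
  (P (\bigcup_i F i) <= (#|I|%:R * p)%:E)%E.
Proof.
move=> mF Fp.
have sub : \bigcup_i F i `<=` \bigcup_(i in [set` enum I]) F i.
  by move=> w [i _ Fi]; exists i => //=; rewrite mem_enum.
apply: (le_trans (content_sub_fsum P _ _ _ sub)) => //.
  by apply: fin_bigcup_measurable => //; exact: finite_finset.
rewrite -fsbig_seq ?enum_uniq//.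
apply: (@le_trans _ _ (\sum_(i <- enum I) p%:E)%E).
  by apply: lee_sum => i _; exact: Fp.
rewrite sumEFin lee_fin big_const_seq count_predT -cardE iter_addr_0.
by rewrite mulr_natl.
Qed.

Theorem theorem3p3 (R : realType)
    (n : nat) (H : 'M[R[i]]_n) (E0 mu1 delta eps Delta c : R) (M : nat)
    (d' : measure_display) (T' : measurableType d') (Q : probability T' R)
    (x : {RV Q >-> R})
    (d : measure_display) (T : measurableType d) (P : probability T R)
    (C : 'I_M -> sampling_call R T) (X : 'I_M -> {RV P >-> R}) :
  0 < delta < 1 -> 0 < eps -> 0 < Delta -> 0 < c < 1 ->
  is_hamiltonian H -> is_ground_energy H E0 -> gap_at_least H E0 Delta ->
  mu1 = E0 ->
  M%:Z = Num.ceil (8 * Delta ^+ 2 / (9 * eps ^+ 2 * (1 - c) ^+ 2) * ln (4 / delta)) ->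
  target_variable x E0 Delta mu1 (c * eps) ->
  (forall i, reliable_call P (C i) (delta / (4 * M%:R))) ->
  (forall i, sample_taken (C i) (X i) x) ->
  mutually_independent P (fun i => call_events (C i) (X i)) ->
  (P (estimation_failure C X mu1 eps) <= delta%:E)%E.
Proof.
move=> /andP[delta0 delta1] eps0 Delta0 /andP[c0 c1] _ _ _ muE ME.
rewrite {mu1}muE => -[xr Ex] rel taken indep.
(* A positive logarithm makes [L] positive, hence [M] nonzero, so that dividing by [M] is legitimate
   below. *)
have ld : 0 < ln (4 / delta).
  by rewrite ln_gt0// ltr_pdivlMr// mul1r (lt_trans delta1)// ltr1n.
have c1' : 0 < 1 - c by rewrite subr_gt0.
pose L := 8 * Delta ^+ 2 / (9 * eps ^+ 2 * (1 - c) ^+ 2) * ln (4 / delta).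
have L0 : 0 < L.
  by rewrite /L mulr_gt0// divr_gt0// ?mulr_gt0// ?exprn_gt0.
have LM : L <= M%:R.
  by have := ceil_ge L; rewrite -[Num.ceil L]ME pmulrn.
have M0 : 0 < M%:R :> R by exact: lt_le_trans LM.
have mF i : measurable (failed (C i)) by have [] := rel i.
(* Half the length of the interval around [E0] that contains [x]. *)
pose r := 2 / 3 * Delta.
have r0 : 0 < r by rewrite /r; lra.
(* What remains of [eps] for the statistical fluctuation after the bias, which is less than
   [c * eps]. *)
pose t := (1 - c) * eps.
have t0 : 0 < t by rewrite mulr_gt0.
have mx : measurable_fun setT x by exact: measurable_funP.
have mxE : measurable_fun setT (fun w => x w - E0) by exact: measurable_funB.
have ix : Q.-integrable setT (EFin \o (fun w => x w - E0)).
  exact: ae_bounded_integrable xr.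
pose m := fine (\int[Q]_w (x w - E0)%:E)%E.
have Em : (\int[Q]_w (x w - E0)%:E = m%:E)%E.
  by rewrite fineK// integrable_fin_num.
have EN : (\int[Q]_w (E0 - x w)%:E = (- m)%:E)%E.
  rewrite -mulN1r EFinM -Em -(integralZl measurableT ix).
  by apply: eq_integral => w _; rewrite /= -EFinM mulN1r opprB.
have mc : `|m| < c * eps.
  move: Ex; rewrite expectation_def.
  have -> : (\int[Q]_w (x w)%:E = (m + E0)%:E)%E.
    rewrite EFinD -Em -[X in (_ + X)%E]mule1 -(probability_setT Q).
    rewrite -integral_cst//.
    rewrite -integralD//; last exact: finite_measure_integrable_cst.
    by apply: eq_integral => w _; rewrite /= -EFinD subrK.
  by rewrite -EFinB addrK lte_fin.
pose g1 (y : R) := y - E0; pose g2 (y : R) := E0 - y.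
have mg1 : measurable_fun setT g1 by exact: measurable_funB.
have mg2 : measurable_fun setT g2 by exact: measurable_funB.
pose tail (g : R -> R) (a : R) := (\bigcap_i ~` failed (C i)) `&`
  [set w | M%:R * (a + t) <= \sum_i g (X i w)].
(* With these [r] and [t] the Chernoff exponent is [M] divided by the factor of [ln (4 / delta)] in
   [L], so [L <= M] makes it at least [ln (4 / delta)]. *)
have bound : expR (- (M%:R * t ^+ 2 / (2 * r ^+ 2))) <= delta / 4.
  have -> : delta / 4 = expR (- ln (4 / delta)).
    by rewrite expRN lnK ?invf_div// posrE divr_gt0.
  rewrite ler_expR lerN2.
  have -> : M%:R * t ^+ 2 / (2 * r ^+ 2) =
      M%:R * (9 * eps ^+ 2 * (1 - c) ^+ 2 / (8 * Delta ^+ 2)).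
    by rewrite /t /r; field; rewrite gt_eqF.
  rewrite -ler_pdivrMr; last by rewrite divr_gt0// ?mulr_gt0// ?exprn_gt0.
  by rewrite invf_div mulrC.
have boundE : ((expR (- (M%:R * t ^+ 2 / (2 * r ^+ 2))))%:E <= (delta / 4)%:E)%E.
  by rewrite lee_fin.
have tail1 : (P (tail g1 m) <= (delta / 4)%:E)%E.
  apply: le_trans boundE.
  apply: (sampled_calls_tail P Q x M C X) => //; exact: ltW.
have tail2 : (P (tail g2 (- m)%R) <= (delta / 4)%:E)%E.
  apply: le_trans boundE.
  apply: (sampled_calls_tail P Q x M C X) => //; first exact: ltW.
  by apply: filterS xr => w; rewrite distrC.
have calls : (P (\bigcup_i failed (C i)) <= (delta / 4)%:E)%E.
  have -> : delta / 4 = #|'I_M|%:R * (delta / (4 * M%:R)).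
    by rewrite card_ord; field; rewrite gt_eqF.
  by apply: measure_finType_bigcup_le => // i; have [] := rel i.
have mtail g a : measurable_fun setT g -> measurable (tail g a).
  move=> mg; apply: measurableI.
    apply: fin_bigcap_measurable; first exact: finite_finset.
    by move=> i _; exact: measurableC.
  rewrite -[X in measurable X]setTI; apply: measurable_fun_ler => //.
  by apply: measurable_sum => i; exact: measurableT_comp.
have mcalls : measurable (\bigcup_i failed (C i)).
  by apply: fin_bigcup_measurable; first exact: finite_finset.
have mt1 : measurable (tail g1 m).
  by apply: mtail; exact: mg1.
have mt2 : measurable (tail g2 (- m)%R).
  by apply: mtail; exact: mg2.
have -> : estimation_failure C X E0 eps = (\bigcup_i failed (C i)) `|`
    ~` [set w | `|sample_average X w - E0| <= eps].
  apply/seteqP; split => w /=.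
    by move=> [[i Fi]|]; [left; exists i|right].
  by move=> [[i _ Fi]|]; [left; exists i|right].
apply: (@le_trans _ _ (P ((\bigcup_i failed (C i)) `|`
    (tail g1 m `|` tail g2 (- m)%R)))).
  apply: le_measure; rewrite ?inE.
  - apply: measurableU => //; apply: measurableC.
    rewrite -[X in measurable X]setTI; apply: measurable_fun_ler => //.
    apply: measurableT_comp => //; apply: measurable_funB => //.
    by apply: measurable_funM => //; apply: measurable_sum.
  - by apply: measurableU => //; exact: measurableU.
  move=> w [|]; first by left.
  have [Fw|/forallNP nF] := pselect (exists i, failed (C i) w).
    by move: Fw => [i Fi]; left; exists i.
  (* Here no call fails and the average is off by more than [eps = c * eps + t]. Since [m] is less
     than [c * eps] in absolute value, the average minus [E0] lies beyond [m + t] or [m - t], which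
     is one of the two tails. *)
  move=> /= /negP; rewrite -ltNge => dev; right.
  have sumE : \sum_i (X i w - E0) = M%:R * (sample_average X w - E0).
    rewrite sumrB sumr_const card_ord /sample_average mulrBr mulrA mulfV ?gt_eqF//.
    by rewrite mul1r mulr_natl.
  move: mc; rewrite ltr_norml => /andP[mc1 mc2].
  move: dev; rewrite ltr_normr => /orP[dev|dev]; [left|right].
  - split; first by move=> i _; exact: nF.
    rewrite /= sumE ler_pM2l// /t; lra.
  - split; first by move=> i _; exact: nF.
    rewrite /= (_ : \sum_i (E0 - X i w) = M%:R * - (sample_average X w - E0)).
      by rewrite ler_pM2l// /t; lra.
    by rewrite mulrN -sumE -sumrN; apply: eq_bigr => i _; rewrite opprB.
apply: (le_trans (measureU2 _ _ _)) => //; first exact: measurableU.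
apply: (le_trans (leeD calls (le_trans (measureU2 _ mt1 mt2) (leeD tail1 tail2)))).
by rewrite -!EFinD lee_fin; lra.
Qed.
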